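(* Let Assumption 1 (regularity) and Assumption 2 (Riccati condition), both stated in the context, hold for the two-player constrained linear-quadratic difference game with initial state $\bar x_0$ described in the context. Consider the problem, over $\mathbf u^1\in\mathbb R^{Km_1}$ and $\boldsymbol\mu\in\mathbb R^{Kc_2}$, $$\mathrm{LCQP}(\bar x_0):\quad \min_{\mathbf u^1,\boldsymbol\mu}\ \tfrac12\left\|\boldsymbol\Delta\begin{bmatrix}\mathbf u^1\\ \boldsymbol\mu\end{bmatrix}+\boldsymbol\xi_0\bar x_0\right\|_{\boldsymbol\Sigma}^2$$ subject to $$\mathbf N^1\mathbf u^1+\mathbf V^1\boldsymbol\mu+\mathbf q^1(\bar x_0)\ge0,\qquad 0\le\boldsymbol\mu\perp\mathbf N^2\mathbf u^1+\mathbf V^2\boldsymbol\mu+\mathbf q^2(\bar x_0)\ge0,$$ with the matrices and vectors defined in the context. Then $(\mathbf u^{1\star},\mathbf u^{2\star})$ is a generalized open-loop Stackelberg equilibrium (GOLSE) of the game if and only if there exists $\boldsymbol\mu^\star$ such that $(\mathbf u^{1\star},\boldsymbol\mu^\star)$ is a global minimizer of $\mathrm{LCQP}(\bar x_0)$ and $\mathbf u^{2\star}=\mathsf R(\mathbf x_l,\mathbf u^{1\star},\boldsymbol\zeta_r,\boldsymbol\mu^\star)$, where $$\boldsymbol\zeta_r=\boldsymbol\Psi\mathbf F\mathbf u^{1\star}+\boldsymbol\Psi\mathbf G\boldsymbol\mu^\star,\qquad \mathbf x_l=\boldsymbol\Phi_0\bar x_0+\boldsymbol\Theta_u\mathbf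 u^{1\star}+\boldsymbol\Theta_\mu\boldsymbol\mu^\star,$$ and, writing $\mathbf x_l=(x_k)_{k\in\mathsf K_l}$, $\boldsymbol\zeta_r=(\zeta_k)_{k\in\mathsf K_r}$, $\boldsymbol\mu=(\mu_k)_{k\in\mathsf K_l}$ in blocks, $\mathsf R(\mathbf x_l,\mathbf u^1,\boldsymbol\zeta_r,\boldsymbol\mu):=\big(L_k^xx_k+L_k^uu_k^1+L_k^\zeta\zeta_{k+1}+L_k^\mu\mu_k\big)_{k\in\mathsf K_l}\in\mathbb R^{Km_2}$ (stacked as a column).
   Context: Notation. $\mathbb S^n$ is the set of real symmetric $n\times n$ matrices; $\|x\|_A^2:=x^\top Ax$ for $A\in\mathbb S^n$ (not necessarily positive semidefinite). Vector inequalities are componentwise. $0\le x\perp y\ge0$ means $x\ge0$, $y\ge0$, $x^\top y=0$. $\mathrm{col}$, $\mathrm{row}$, $\mathrm{Bdg}$ denote block column, block row and block diagonal matrices formed from the listed blocks, in increasing order of the index. $\mathrm I_n$ is the $n\times n$ identity matrix. Game. Player $1$ is the leader, player $2$ the follower. $K\ge1$ is an integer, $\mathsf K=\{0,1,\dots,K\}$, $\mathsf K_l=\{0,\dots,K-1\}$, $\mathsf K_r=\{1,\dots,K\}$. The dynamics are $$x_{k+1}=A_kx_k+B_k^1u_k^1+B_k^2u_k^2,\quad k\in\mathsf K_l,\qquad x_0=\bar x_0,$$ with $A_k\in\mathbb R^{n\times n}$, $B_k^i\in\mathbb R^{n\times m_i}$, $u_k^i\in\mathbb R^{m_i}$, and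 given $\bar x_0\in\mathbb R^n$. An open-loop strategy of player $i$ is $\mathbf u^i=(u_k^i)_{k\in\mathsf K_l}\in\mathbb R^{Km_i}$; $x_k(\mathbf u^1,\mathbf u^2)$ is the resulting state at time $k$. For $i\in\{1,2\}$, $k\in\mathsf K_l$, the constraints of player $i$ are $$g_k^i(x_k,u_k^1,u_k^2):=M_k^ix_k+N_k^{i1}u_k^1+N_k^{i2}u_k^2+r_k^i\ge0,$$ with $M_k^i\in\mathbb R^{c_i\times n}$, $N_k^{ij}\in\mathbb R^{c_i\times m_j}$, $r_k^i\in\mathbb R^{c_i}$. The cost minimized by player $i$ is $$J_i(\mathbf u^1,\mathbf u^2)=\tfrac12\|x_K\|_{Q_K^i}^2+\tfrac12\sum_{k\in\mathsf K_l}\big(\|x_k\|_{Q_k^i}^2+\|u_k^1\|_{R_k^{i1}}^2+\|u_k^2\|_{R_k^{i2}}^2\big),$$ evaluated along the resulting state trajectory, with $Q_k^i\in\mathbb S^n$ ($k\in\mathsf K$), $R_k^{ij}\in\mathbb S^{m_j}$ ($k\in\mathsf K_l$). Feasible and reaction sets. $\Omega_2(\mathbf u^1):=\{\mathbf u^2\in\mathbb R^{Km_2}: g_k^2(x_k(\mathbf u^1,\mathbf u^2),u_k^1,u_k^2)\ge0\ \forall k\in\mathsf K_l\}$; $\mathsf U_1:=\{\mathbf u^1\in\mathbb R^{Km_1}:\Omega_2(\mathbf u^1)\ne\varnothing\}$; for $\mathbf u^1\in\mathsf U_1$, $\mathsf T(\mathbf u^1):=\arg\min_{\mathbf u^2\in\Omega_2(\mathbf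 u^1)}J_2(\mathbf u^1,\mathbf u^2)$ (when single-valued, identified with its unique element, whose stage-$k$ component is $\mathsf T_k(\mathbf u^1)$); $\Omega_1:=\{\mathbf u^1\in\mathsf U_1:\mathsf T(\mathbf u^1)\text{ is single-valued and } g_k^1(x_k(\mathbf u^1,\mathsf T(\mathbf u^1)),u_k^1,\mathsf T_k(\mathbf u^1))\ge0\ \forall k\in\mathsf K_l\}$. Equilibrium. $(\mathbf u^{1\star},\mathbf u^{2\star})$ is a generalized open-loop Stackelberg equilibrium (GOLSE) if (i) $\mathbf u^{1\star}\in\Omega_1$ and $\mathbf u^{2\star}=\mathsf T(\mathbf u^{1\star})$; (ii) $J_1(\mathbf u^{1\star},\mathsf T(\mathbf u^{1\star}))\le J_1(\mathbf u^1,\mathsf T(\mathbf u^1))$ for all $\mathbf u^1\in\Omega_1$. Assumption 1. (1) $\mathsf U_1\neq\varnothing$; (2) for each $\mathbf u^1\in\mathsf U_1$, $\Omega_2(\mathbf u^1)$ is bounded. Assumption 2. The solution of the Riccati difference equation $$P_k=Q_k^2+A_k^\top P_{k+1}A_k-V_k^\top\Gamma_k^{-1}V_k,\quad P_K=Q_K^2,\qquad \Gamma_k:=R_k^{22}+{B_k^2}^\top P_{k+1}B_k^2,\quad V_k:={B_k^2}^\top P_{k+1}A_k,$$ $k\in\mathsf K_l$, exists, and $\Gamma_k$ is positive definite for every $k\in\mathsf K_l$. Stagewise derived matrices ($k\in\mathsf K_l$). $L_k^x:=-\Gamma_k^{-1}V_k$, $L_k^u:=-\Gamma_k^{-1}{B_k^2}^\top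 P_{k+1}B_k^1$, $L_k^\zeta:=-\Gamma_k^{-1}{B_k^2}^\top$, $L_k^\mu:=\Gamma_k^{-1}{N_k^{22}}^\top$; $\overline A_k:=A_k+B_k^2L_k^x$, $\overline B_k:=B_k^1+B_k^2L_k^u$, $\overline C_k:=B_k^2L_k^\mu$, $\overline D_k:=B_k^2L_k^\zeta$, $\overline F_k:=A_k^\top P_{k+1}B_k^1+V_k^\top L_k^u$, $\overline G_k:=V_k^\top L_k^\mu-{M_k^2}^\top$; for $i\in\{1,2\}$: $E_k^i:=M_k^i+N_k^{i2}L_k^x$, $S_k^i:=N_k^{i1}+N_k^{i2}L_k^u$, $W_k^i:=N_k^{i2}L_k^\zeta$, $U_k^i:=N_k^{i2}L_k^\mu$. Aggregate matrices. Transition matrices: $\Psi_{k,j}:=\overline A_k^\top\overline A_{k+1}^\top\cdots\overline A_{j-1}^\top$ for $k\le j$ in $\mathsf K_l$, $\Psi_{k,k}=\mathrm I_n$; $\Phi_{k,i}:=\overline A_{k-1}\overline A_{k-2}\cdots\overline A_i$ for $k\ge i$ in $\mathsf K$, $\Phi_{k,k}=\mathrm I_n$. $\boldsymbol\Phi_0=\mathrm{col}\{\Phi_{k,0}\}_{k\in\mathsf K_l}$; $\mathbf B,\mathbf C,\mathbf D,\mathbf F,\mathbf G$ are $\mathrm{Bdg}\{\cdot\}_{k\in\mathsf K_l}$ of $\overline B_k,\overline C_k,\overline D_k,\overline F_k,\overline G_k$ respectively. With block indices $i,j\in\mathsf K_r$: $[\boldsymbol\Psi]_{ij}:=0_{n\times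 n}$ if $i\ge j$ and $\Psi_{i,j-1}$ if $i<j$; $[\boldsymbol\Phi]_{ij}:=\Phi_{i-1,j}$ if $i>j$ and $0_{n\times n}$ if $i\le j$. For $i\in\{1,2\}$: $\mathbf E^i,\mathbf S^i,\mathbf W^i,\mathbf U^i$ are $\mathrm{Bdg}\{\cdot\}_{k\in\mathsf K_l}$ of $E_k^i,S_k^i,W_k^i,U_k^i$; $\mathbf r^i=\mathrm{col}\{r_k^i\}_{k\in\mathsf K_l}$; $\mathbf T^i:=\mathbf E^i\boldsymbol\Phi\mathbf D+\mathbf W^i$; $\mathbf q^i(\bar x_0):=\mathbf E^i\boldsymbol\Phi_0\bar x_0+\mathbf r^i$; $\mathbf N^i:=\mathbf E^i\boldsymbol\Phi\mathbf B+\mathbf S^i+\mathbf T^i\boldsymbol\Psi\mathbf F$; $\mathbf V^i:=\mathbf E^i\boldsymbol\Phi\mathbf C+\mathbf U^i+\mathbf T^i\boldsymbol\Psi\mathbf G$. $\boldsymbol\Theta_u:=\boldsymbol\Phi\mathbf B+\boldsymbol\Phi\mathbf D\boldsymbol\Psi\mathbf F$, $\boldsymbol\Theta_\mu:=\boldsymbol\Phi\mathbf C+\boldsymbol\Phi\mathbf D\boldsymbol\Psi\mathbf G$; $\boldsymbol\Phi_K:=\mathrm{row}\{\Phi_{K,k}\}_{k\in\mathsf K_r}$; $\mathbf L^\alpha=\mathrm{Bdg}\{L_k^\alpha\}_{k\in\mathsf K_l}$ for $\alpha\in\{x,u,\zeta,\mu\}$; $\boldsymbol\Lambda_u:=\mathbf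 L^x\boldsymbol\Theta_u+\mathbf L^u+\mathbf L^\zeta\boldsymbol\Psi\mathbf F$, $\boldsymbol\Lambda_\mu:=\mathbf L^x\boldsymbol\Theta_\mu+\mathbf L^\zeta\boldsymbol\Psi\mathbf G+\mathbf L^\mu$, $\boldsymbol\Lambda_0:=\mathbf L^x\boldsymbol\Phi_0$; $\boldsymbol\vartheta_u:=\boldsymbol\Phi_K(\mathbf B+\mathbf D\boldsymbol\Psi\mathbf F)$, $\boldsymbol\vartheta_\mu:=\boldsymbol\Phi_K(\mathbf C+\mathbf D\boldsymbol\Psi\mathbf G)$; $\mathbf Q^1=\mathrm{Bdg}\{Q_k^1\}_{k\in\mathsf K_l}$, $\mathbf R^{11}=\mathrm{Bdg}\{R_k^{11}\}_{k\in\mathsf K_l}$, $\mathbf R^{12}=\mathrm{Bdg}\{R_k^{12}\}_{k\in\mathsf K_l}$; $$\boldsymbol\Sigma=\mathrm{Bdg}(Q_K^1,\mathbf Q^1,\mathbf R^{11},\mathbf R^{12}),\qquad \boldsymbol\xi_0=\begin{bmatrix}\Phi_{K,0}\\ \boldsymbol\Phi_0\\ 0_{Km_1\times n}\\ \boldsymbol\Lambda_0\end{bmatrix},\qquad \boldsymbol\Delta=\begin{bmatrix}\boldsymbol\vartheta_u&\boldsymbol\vartheta_\mu\\ \boldsymbol\Theta_u&\boldsymbol\Theta_\mu\\ \mathrm I_{Km_1}&0_{Km_1\times Kc_2}\\ \boldsymbol\Lambda_u&\boldsymbol\Lambda_\mu\end{bmatrix}.$$ *)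

(* Defs.v *)
From HB Require Import structures.
From mathcomp Require Import all_boot all_order all_algebra.
From mathcomp Require Import all_classical all_reals all_analysis.

Set Implicit Arguments.
Unset Strict Implicit.
Unset Printing Implicit Defensive.

Import Order.TTheory GRing.Theory Num.Theory.
Import numFieldNormedType.Exports.

Local Open Scope classical_set_scope.
Local Open Scope ring_scope.

(* Index of K stacked blocks of size p. It is a sum rather than K * p so that *)
(* it is literally the index of the library's block matrices with constant    *)
(* block sizes.                                                               *)
Notation stacked K p := (\sum_(k < K) p)%N.

Section Generic.
Context {R : realType}.

Definition vec_ge0 {p : nat} (x : 'cV[R]_p) : Prop := forall i, 0 <= x i 0.

Definition complementary {p : nat} (x y : 'cV[R]_p) : Prop :=
  [/\ vec_ge0 x, vec_ge0 y & (x^T *m y) 0 0 = 0].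

Definition wnorm2 {p : nat} (A : 'M[R]_p) (x : 'cV[R]_p) : R :=
  (x^T *m A *m x) 0 0.

Definition posdef {p : nat} (A : 'M[R]_p) : Prop :=
  A \is symmetricmx /\ forall x : 'cV[R]_p, x != 0 -> 0 < wnorm2 A x.

(* Block k of a stacked vector, for k : nat; the value 0 for K <= k is junk. *)
Definition blk {K p : nat} (u : 'cV[R]_(stacked K p)) (k : nat) : 'cV[R]_p :=
  if insub k is Some j then submxcol u (j : 'I_K) else 0.

(* The library's \mxdiag requires square blocks. *)
Definition Bdg (K : nat) {p q : nat} (B : nat -> 'M[R]_(p, q)) :
    'M[R]_(stacked K p, stacked K q) :=
  \mxblock_(i < K, j < K) (if i == j then B i else 0).

End Generic.

Inductive player := leader | follower.

(* Only stages k < K (k <= K for costQ) of the data are meaningful; no        *)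
(* definition below looks at the other values.                                *)
Record lqgame (R : realType) (K n : nat) (m c : player -> nat) := LQGame {
  init : 'cV[R]_n;
  dynA : nat -> 'M[R]_n;
  dynB : forall i : player, nat -> 'M[R]_(n, m i);
  conM : forall i : player, nat -> 'M[R]_(c i, n);
  conN : forall i j : player, nat -> 'M[R]_(c i, m j);
  conr : forall i : player, nat -> 'cV[R]_(c i);
  costQ : player -> nat -> 'M[R]_n;
  costR : forall i j : player, nat -> 'M[R]_(m j);
  costQ_sym : forall i k, (k <= K)%N -> costQ i k \is symmetricmx;
  costR_sym : forall i j k, (k < K)%N -> costR i j k \is symmetricmx }.

Section Game.
Context {R : realType} {K n : nat} {m c : player -> nat}.
Context (G : lqgame R K n m c).

Notation strategy i := 'cV[R]_(stacked K (m i)).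

Fixpoint state (u1 : strategy leader) (u2 : strategy follower) (k : nat) :
    'cV[R]_n :=
  if k is k'.+1 then
    dynA G k' *m state u1 u2 k' + dynB G leader k' *m blk u1 k'
    + dynB G follower k' *m blk u2 k'
  else init G.

Definition constraint (i : player) (k : nat) (x : 'cV[R]_n)
    (v : 'cV[R]_(m leader)) (w : 'cV[R]_(m follower)) : 'cV[R]_(c i) :=
  conM G i k *m x + conN G i leader k *m v + conN G i follower k *m w
  + conr G i k.

Definition admissible (i : player) (u1 : strategy leader)
    (u2 : strategy follower) : Prop :=
  forall k : nat, (k < K)%N ->
    vec_ge0 (constraint i k (state u1 u2 k) (blk u1 k) (blk u2 k)).

Definition cost (i : player) (u1 : strategy leader)
    (u2 : strategy follower) : R :=
  2%:R^-1 * wnorm2 (costQ G i K) (state u1 u2 K)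
  + 2%:R^-1 * \sum_(k < K) (wnorm2 (costQ G i k) (state u1 u2 k)
                            + wnorm2 (costR G i leader k) (blk u1 k)
                            + wnorm2 (costR G i follower k) (blk u2 k)).

Definition Omega2 (u1 : strategy leader) : set (strategy follower) :=
  [set u2 | admissible follower u1 u2].

Definition U1 : set (strategy leader) := [set u1 | Omega2 u1 !=set0].

Definition reaction (u1 : strategy leader) : set (strategy follower) :=
  [set u2 | Omega2 u1 u2 /\
    forall v, Omega2 u1 v -> cost follower u1 u2 <= cost follower u1 v].

Definition Omega1 : set (strategy leader) :=
  [set u1 | U1 u1 /\
    exists2 u2, reaction u1 = [set u2] & admissible leader u1 u2].

Definition GOLSE (u1s : strategy leader) (u2s : strategy follower) : Prop :=
  [/\ Omega1 u1s,
      reaction u1s = [set u2s] &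
      forall u1 u2, Omega1 u1 -> reaction u1 = [set u2] ->
        cost leader u1s u2s <= cost leader u1 u2].

Definition regularity : Prop :=
  U1 !=set0 /\ forall u1, U1 u1 -> bounded_set (Omega2 u1).

(* P_0, ..., P_K is a sequence of matrices, intended to be the solution of    *)
(* the Riccati difference equation.                                           *)
Context (P : nat -> 'M[R]_n).

Local Notation A := (dynA G).
Local Notation B1 := (dynB G leader).
Local Notation B2 := (dynB G follower).

Definition Gamma k : 'M[R]_(m follower) :=
  costR G follower follower k + (B2 k)^T *m P k.+1 *m B2 k.
Definition Vmx k : 'M[R]_(m follower, n) := (B2 k)^T *m P k.+1 *m A k.

Definition riccati_solution : Prop :=
  P K = costQ G follower K /\
  forall k, (k < K)%N ->
    Gamma k \in unitmx /\
    P k = costQ G follower k + (A k)^T *m P k.+1 *m A k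
          - (Vmx k)^T *m invmx (Gamma k) *m Vmx k.

Definition riccati_condition : Prop :=
  riccati_solution /\ forall k, (k < K)%N -> posdef (Gamma k).

Definition Lx k := - (invmx (Gamma k) *m Vmx k).
Definition Lu k := - (invmx (Gamma k) *m (B2 k)^T *m P k.+1 *m B1 k).
Definition Lzeta k := - (invmx (Gamma k) *m (B2 k)^T).
Definition Lmu k := invmx (Gamma k) *m (conN G follower follower k)^T.

Definition Abar k := A k + B2 k *m Lx k.
Definition Bbar k := B1 k + B2 k *m Lu k.
Definition Cbar k := B2 k *m Lmu k.
Definition Dbar k := B2 k *m Lzeta k.
Definition Fbar k := (A k)^T *m P k.+1 *m B1 k + (Vmx k)^T *m Lu k.
Definition Gbar k := (Vmx k)^T *m Lmu k - (conM G follower k)^T.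

Definition Emx i k := conM G i k + conN G i follower k *m Lx k.
Definition Smx i k := conN G i leader k + conN G i follower k *m Lu k.
Definition Wmx i k := conN G i follower k *m Lzeta k.
Definition Umx i k := conN G i follower k *m Lmu k.

Definition Psi (k j : nat) : 'M[R]_n :=
  \big[mulmx/1%:M]_(l <- index_iota k j) (Abar l)^T.
Definition Phi (k i : nat) : 'M[R]_n :=
  \big[mulmx/1%:M]_(l <- rev (index_iota i k)) Abar l.

(* Block indices of PsiB, PhiB (and PhiK) range over {1, ..., K}: the ordinal *)
(* i : 'I_K stands for the block index i.+1.                                  *)
Definition PsiB : 'M[R]_(stacked K n, stacked K n) :=
  \mxblock_(i < K, j < K) (if (i < j)%N then Psi i.+1 j else 0).
Definition PhiB : 'M[R]_(stacked K n, stacked K n) :=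
  \mxblock_(i < K, j < K) (if (j < i)%N then Phi i j.+1 else 0).
Definition PhiK : 'M[R]_(n, stacked K n) := \mxrow_(j < K) Phi K j.+1.
Definition Phi0 : 'M[R]_(stacked K n, n) := \mxcol_(k < K) Phi k 0.

Definition BB := Bdg K Bbar.
Definition CC := Bdg K Cbar.
Definition DD := Bdg K Dbar.
Definition FF := Bdg K Fbar.
Definition GG := Bdg K Gbar.

Definition EE i := Bdg K (Emx i).
Definition SS i := Bdg K (Smx i).
Definition WW i := Bdg K (Wmx i).
Definition UU i := Bdg K (Umx i).
Definition rr i : 'cV[R]_(stacked K (c i)) := \mxcol_(k < K) conr G i k.

Definition TT i := EE i *m PhiB *m DD + WW i.
Definition qq i := EE i *m Phi0 *m init G + rr i.
Definition NN i := EE i *m PhiB *m BB + SS i + TT i *m PsiB *m FF.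
Definition VV i := EE i *m PhiB *m CC + UU i + TT i *m PsiB *m GG.

Definition Theta_u := PhiB *m BB + PhiB *m DD *m PsiB *m FF.
Definition Theta_mu := PhiB *m CC + PhiB *m DD *m PsiB *m GG.

Definition LLx := Bdg K Lx.
Definition LLu := Bdg K Lu.
Definition LLzeta := Bdg K Lzeta.
Definition LLmu := Bdg K Lmu.

Definition Lambda_u := LLx *m Theta_u + LLu + LLzeta *m PsiB *m FF.
Definition Lambda_mu := LLx *m Theta_mu + LLzeta *m PsiB *m GG + LLmu.
Definition Lambda_0 := LLx *m Phi0.

Definition theta_u := PhiK *m (BB + DD *m PsiB *m FF).
Definition theta_mu := PhiK *m (CC + DD *m PsiB *m GG).

Local Notation size_all :=
  (n + (stacked K n + (stacked K (m leader) + stacked K (m follower))))%N.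

Definition Sigma : 'M[R]_size_all :=
  block_mx (costQ G leader K) 0 0
    (block_mx (Bdg K (costQ G leader)) 0 0
      (block_mx (Bdg K (costR G leader leader)) 0 0
                (Bdg K (costR G leader follower)))).

Definition xi0 : 'M[R]_(size_all, n) :=
  col_mx (Phi K 0) (col_mx Phi0 (col_mx 0 Lambda_0)).

Definition Delta :
    'M[R]_(size_all, stacked K (m leader) + stacked K (c follower)) :=
  col_mx (row_mx theta_u theta_mu)
    (col_mx (row_mx Theta_u Theta_mu)
      (col_mx (row_mx 1%:M 0)
              (row_mx Lambda_u Lambda_mu))).

Definition LCQP_objective (u1 : strategy leader)
    (mu : 'cV[R]_(stacked K (c follower))) : R :=
  2%:R^-1 * wnorm2 Sigma (Delta *m col_mx u1 mu + xi0 *m init G).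

Definition LCQP_feasible (u1 : strategy leader)
    (mu : 'cV[R]_(stacked K (c follower))) : Prop :=
  vec_ge0 (NN leader *m u1 + VV leader *m mu + qq leader) /\
  complementary mu (NN follower *m u1 + VV follower *m mu + qq follower).

Definition LCQP_minimizer (u1 : strategy leader)
    (mu : 'cV[R]_(stacked K (c follower))) : Prop :=
  LCQP_feasible u1 mu /\
  forall v nu, LCQP_feasible v nu ->
    LCQP_objective u1 mu <= LCQP_objective v nu.

(* zr stacks zeta_1, ..., zeta_K, so that its block k is zeta_(k+1). *)
Definition response (xl : 'cV[R]_(stacked K n)) (u1 : strategy leader)
    (zr : 'cV[R]_(stacked K n)) (mu : 'cV[R]_(stacked K (c follower))) :
    strategy follower :=
  \mxcol_(k < K) (Lx k *m blk xl k + Lu k *m blk u1 k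
                  + Lzeta k *m blk zr k + Lmu k *m blk mu k).

End Game.

(* Main.v *)
Require Import Defs.
From mathcomp Require Import all_boot all_order all_algebra.
From mathcomp Require Import all_classical all_reals all_analysis.
From mathcomp Require Import ring lra.

Set Implicit Arguments.
Unset Strict Implicit.
Unset Printing Implicit Defensive.

Import Order.TTheory GRing.Theory Num.Theory.
Local Open Scope ring_scope.

(** The follower's problem is a strictly convex quadratic program with affine
    constraints, so its optimality conditions describe the reaction map
    exactly; the leader's complementarity program is the leader's cost
    minimized over the solutions of these conditions, written out in the
    stacked variables.

    Fix the leader's strategy [u1].  Moving the follower's strategy from [u2]
    to [u2 + t d] changes the states linearly, hence the constraints linearly
    and the cost quadratically in [t] ([state_shift], [constraints_shift],
    [cost_shift]).  For costates of the form [P_k x_k + zeta_k], the Riccati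
    recursion turns the derivative of the Lagrangian in the direction [d] into
    the sum over the stages of
      [e_k^T Gamma_k (d_k - Lx_k y_k)],
    where [y] is the variation of the state caused by [d] and [e_k] is the gap
    between the control of stage [k] and the feedback law
      [Lx_k x_k + Lu_k u1_k + Lzeta_k zeta_(k+1) + Lmu_k mu_k]
    ([variation_identity]).  This single identity has two consequences.

    - With all data except [d] equal to zero it says that the second-order
      term of the cost is half the sum of the squared [Gamma_k]-norms of
      [d_k - Lx_k y_k].  Since [y_0 = 0], these all vanish only for [d = 0], so
      the cost is strictly convex in the follower's strategy
      ([cost_hess_eq0]).

    - The Lagrangian is stationary if and only if every [e_k] vanishes, because
      some direction [d] satisfies [d_k - Lx_k y_k = e_k] for all [k]
      ([deviation_direction]).

    As the constraints are affine, Farkas' lemma supplies multipliers at every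
    minimizer without any constraint qualification ([kkt_necessary]).  Hence
    [u2] is the unique optimal reaction to [u1] if and only if it obeys the
    feedback law for some [mu] complementary to the follower's constraints
    ([reaction_complementarity]).

    It remains to solve the linear recursions for [x] and [zeta].  The
    transition matrices give the states, the costates and the response as
    affine functions of [(u1, mu)] ([states_stacked], [costates_stacked],
    [response_stacked]).  Through them the feasible points of the program are
    exactly the pairs formed by an element of [Omega1] and a multiplier of the
    reaction to it ([LCQP_feasible_Omega1], [Omega1_LCQP_feasible]), and the
    objective is the leader's cost ([objective_cost]); the two minimizations
    are the same. *)

(** * Scalar products *)

Section Dot.
Context {R : realType}.
Implicit Types p q : nat.

Definition dot p (x y : 'cV[R]_p) : R := (x^T *m y) 0 0.

Lemma dotE p (x y : 'cV[R]_p) : dot x y = \sum_i x i 0 * y i 0.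
Proof. by rewrite /dot mxE; apply: eq_bigr => i _; rewrite mxE. Qed.

Lemma dotC p (x y : 'cV[R]_p) : dot x y = dot y x.
Proof. by rewrite !dotE; apply: eq_bigr => i _; rewrite mulrC. Qed.

Lemma dotDl p (x y z : 'cV[R]_p) : dot (x + y) z = dot x z + dot y z.
Proof. by rewrite /dot linearD mulmxDl mxE. Qed.

Lemma dotDr p (x y z : 'cV[R]_p) : dot z (x + y) = dot z x + dot z y.
Proof. by rewrite /dot mulmxDr mxE. Qed.

Lemma dotZr p a (x y : 'cV[R]_p) : dot x (a *: y) = a * dot x y.
Proof. by rewrite /dot -scalemxAr mxE. Qed.

Lemma dotZl p a (x y : 'cV[R]_p) : dot (a *: x) y = a * dot x y.
Proof. by rewrite dotC dotZr dotC. Qed.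

Lemma dotNr p (x y : 'cV[R]_p) : dot x (- y) = - dot x y.
Proof. by rewrite -scaleN1r dotZr mulN1r. Qed.

Lemma dotNl p (x y : 'cV[R]_p) : dot (- x) y = - dot x y.
Proof. by rewrite dotC dotNr dotC. Qed.

Lemma dot0r p (x : 'cV[R]_p) : dot x 0 = 0.
Proof. by rewrite /dot mulmx0 mxE. Qed.

Lemma dotMr p q (A : 'M[R]_(p, q)) x y : dot x (A *m y) = dot (A^T *m x) y.
Proof. by rewrite /dot trmx_mul trmxK mulmxA. Qed.

Lemma wnorm2E p (A : 'M[R]_p) x : wnorm2 A x = dot x (A *m x).
Proof. by rewrite /wnorm2 /dot mulmxA. Qed.

Lemma symmetric_tr p (S : 'M[R]_p) : S \is symmetricmx -> S^T = S.
Proof.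
move=> /is_hermitianmxP SE; rewrite {2}SE expr0 scale1r.
by apply/matrixP => i j; rewrite !mxE.
Qed.

Lemma mxDE p q (X Y : 'M[R]_(p, q)) i j : (X + Y) i j = X i j + Y i j.
Proof. by rewrite mxE. Qed.

Lemma mxNE p q (X : 'M[R]_(p, q)) i j : (- X) i j = - X i j.
Proof. by rewrite mxE. Qed.

Lemma wnorm2_shift p (S : 'M[R]_p) x t y : S^T = S ->
  wnorm2 S (x + t *: y)
  = wnorm2 S x + (2%:R * t) * dot (S *m x) y + t ^+ 2 * wnorm2 S y.
Proof.
move=> ST; rewrite !wnorm2E !(mulmxDr, dotDr, dotDl, dotZr, dotZl) -!scalemxAr.
rewrite !dotZr [dot x (S *m y)]dotMr ST [dot y (S *m x)]dotC; ring.
Qed.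

End Dot.

(** * Multipliers for linearly constrained quadratic minimization *)

(** Induction on the number of forms, following Bartl.  If the form [a j] is
    not redundant, some [z] satisfies the remaining inequalities but has
    [b z < 0], hence [a j z < 0].  Projecting onto the kernel of [a j] along
    [z] eliminates [a j], and the signs of [a j z] and [b z] make its
    multiplier nonnegative. *)
Lemma farkas (R : realType) (V : lmodType R) (I : eqType) (s : seq I)
    (a : I -> V -> R) (b : V -> R) :
  uniq s -> (forall i, scalar (a i)) -> scalar b ->
  (forall x, (forall i, i \in s -> 0 <= a i x) -> 0 <= b x) ->
  exists l : I -> R,
    (forall i, 0 <= l i) /\ forall x, b x = \sum_(i <- s) l i * a i x.
Proof.
elim: s a b => [|j s IHs] a b.
  move=> _ _ b_lin b_ge0; exists (fun=> 0); split=> // x; rewrite big_nil.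
  have b0 : b 0 = 0.
    by have := b_lin (-1) 0 0; rewrite scaler0 addr0 mulN1r addNr.
  have bN : b (- x) = - b x.
    by have := b_lin (-1) x 0; rewrite scaleN1r addr0 b0 addr0 mulN1r.
  by apply/eqP; rewrite eq_le b_ge0 // andbT -oppr_ge0 -bN b_ge0.
move=> /= /andP[js us] a_lin b_lin b_ge0.
have [b_ge0_s|] :=
  pselect (forall x, (forall i, i \in s -> 0 <= a i x) -> 0 <= b x).
  have [l [l_ge0 bE]] := IHs a b us a_lin b_lin b_ge0_s.
  exists (fun i => if i == j then 0 else l i); split=> [i|x].
    by case: ifP.
  rewrite big_cons eqxx mul0r add0r bE; apply: eq_big_seq => i i_s.
  by case: eqP => // ij; rewrite -ij i_s in js.
move=> /existsNP[z] /not_implyP[az /negP]; rewrite -ltNge => bz.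
have ajz : a j z < 0.
  rewrite ltNge; apply/negP => ajz; have := b_ge0 z; rewrite leNgt bz => b_abs.
  suff: false by [].
  by apply: b_abs => i; rewrite inE => /orP[/eqP->//|/az].
(* the projection onto the kernel of [a j] along [z] *)
pose y x := x - (a j x / a j z) *: z.
have scalarN (f : V -> R) k x u : scalar f -> f (x - k *: u) = f x - k * f u.
  by move=> f_lin; rewrite [x - _]addrC -scaleNr f_lin; ring.
have a'_lin i : scalar (fun x => a i (y x)).
  by move=> k u v; rewrite !scalarN// !a_lin; ring.
have b'_lin : scalar (fun x => b (y x)).
  by move=> k u v; rewrite !scalarN// b_lin a_lin; ring.
have [x ax|l [l_ge0 bE]] := IHs _ _ us a'_lin b'_lin.
  apply: b_ge0 => i; rewrite inE => /orP[/eqP->|/ax//].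
  by rewrite scalarN// divfK ?lt_eqF// subrr.
exists (fun i => if i == j then (b z - \sum_(k <- s) l k * a k z) / a j z
                 else l i); split=> [i|x].
  case: ifP => // _; apply: mulr_le0; last by rewrite invr_le0 ltW.
  rewrite subr_le0 (le_trans (ltW bz))// big_seq sumr_ge0// => k ks.
  by rewrite mulr_ge0// az.
rewrite big_cons eqxx; set S := \sum_(k <- s) l k * a k z.
rewrite [X in _ = _ + X](_ : _ = b (y x) + a j x / a j z * S).
  by rewrite scalarN//; ring.
rewrite bE mulr_sumr -big_split; apply: eq_big_seq => i i_s /=.
case: eqP => [ij|_]; first by rewrite -ij i_s in js.
by rewrite scalarN//; ring.
Qed.

(** The inactive constraints are finitely many and strict, so together they
    tolerate a step of positive length. *)
Lemma feasible_step (R : realType) (p : nat) (g d : 'cV[R]_p) :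
  vec_ge0 g -> (forall i, g i 0 = 0 -> 0 <= d i 0) ->
  exists2 t : R, 0 < t & forall s, 0 <= s <= t -> vec_ge0 (g + s *: d).
Proof.
move=> g_ge0 d_ge0.
pose r i := g i 0 / (1 + `|d i 0|).
have den i : 0 < 1 + `|d i 0| by rewrite ltr_pwDl.
exists (\big[Order.min/1]_(i | g i 0 != 0) r i).
  by apply: lt_bigmin => // i gi; rewrite divr_gt0// lt_def gi g_ge0.
move=> s /andP[s_ge0 s_le] i; rewrite !mxE.
have [gi0|gi] := eqVneq (g i 0) 0; first by rewrite gi0 add0r mulr_ge0 // d_ge0.
have : s <= r i by apply: le_trans s_le _; exact: bigmin_le_cond.
rewrite ler_pdivlMr// => s_ri.
have := mulr_ge0 s_ge0 (normr_ge0 (d i 0)).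
have := ler_norm (- (s * d i 0)); rewrite normrN normrM (ger0_norm s_ge0); lra.
Qed.

(** Along a direction that is feasible to first order, minimality forces the
    linear term [l] to be nonnegative; Farkas' lemma, applied to the active
    rows of [D], then represents [l] by nonnegative multipliers. *)
Lemma kkt_necessary (R : realType) (V : lmodType R) (p : nat)
    (J l q : V -> R) (g D : V -> 'cV[R]_p) (u : V) :
  scalar l -> (forall a x y, D (a *: x + y) = a *: D x + D y) ->
  (forall t d, J (u + t *: d) = J u + t * l d + t ^+ 2 * q d) ->
  (forall t d, g (u + t *: d) = g u + t *: D d) ->
  vec_ge0 (g u) -> (forall v, vec_ge0 (g v) -> J u <= J v) ->
  exists mu : 'cV[R]_p,
    complementary mu (g u) /\ forall d, l d = dot mu (D d).
Proof.
move=> l_lin D_lin JE gE gu_ge0 u_min.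
pose act i := g u i 0 == 0.
have act_uniq : uniq [seq i <- enum 'I_p | act i].
  exact/filter_uniq/enum_uniq.
have rows_lin i : scalar (fun d => D d i 0) by move=> a x y; rewrite D_lin !mxE.
have [d|mu [mu_ge0 lE]] := farkas act_uniq rows_lin l_lin.
  move=> Dd_ge0; rewrite leNgt; apply/negP => ld.
  have [|t t_gt0 t_feas] := @feasible_step R p (g u) (D d) gu_ge0.
    by move=> i /eqP gi; apply: Dd_ge0; rewrite mem_filter mem_enum andbT.
  (* a step this short keeps the quadratic term below half of the linear one *)
  pose s := Num.min t (- l d / (2%:R * (1 + `|q d|))).
  have den : 0 < 2%:R * (1 + `|q d|) by rewrite mulr_gt0// ltr_pwDl.
  have s_gt0 : 0 < s by rewrite lt_min t_gt0 divr_gt0// oppr_gt0.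
  have : s <= - l d / (2%:R * (1 + `|q d|)) by rewrite ge_min lexx orbT.
  rewrite ler_pdivlMr// => s_le.
  have : J u <= J (u + s *: d).
    by apply: u_min; rewrite gE; apply: t_feas; rewrite ltW//= ge_min lexx.
  rewrite JE -addrA lerDl expr2 -mulrA -mulrDr pmulr_rge0// leNgt.
  move=> /negP; apply.
  have := ler_wpM2l (ltW s_gt0) (ler_norm (q d)); nra.
exists (\col_i (if act i then mu i else 0)); split.
  split=> //; first by move=> i; rewrite mxE; case: ifP.
  rewrite -/(dot _ _) dotE big1// => i _; rewrite mxE /act.
  by case: eqP => [->|_]; rewrite ?mulr0 ?mul0r.
move=> d; rewrite lE big_filter big_mkcond big_enum dotE /=.
by apply: eq_bigr => i _; rewrite mxE; case: ifP => // _; rewrite mul0r.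
Qed.

(** * Blocks of stacked vectors *)

Section Blocks.
Context {R : realType} {K : nat}.
Implicit Types p q : nat.

Lemma blk_ord p (u : 'cV[R]_(stacked K p)) (k : 'I_K) :
  blk u k = submxcol u k.
Proof. by rewrite /blk valK. Qed.

Lemma blk_mxcol p (f : nat -> 'cV[R]_p) k :
  (k < K)%N -> blk (\mxcol_(i < K) f i) k = f k.
Proof. by move=> kK; rewrite (blk_ord _ (Ordinal kK)) mxcolK. Qed.

Lemma mxcol_blk p (u : 'cV[R]_(stacked K p)) : u = \mxcol_(k < K) blk u k.
Proof.
by rewrite -[LHS]submxcolK; apply: eq_mxcol => k; rewrite blk_ord.
Qed.

Lemma blk_inj p (u v : 'cV[R]_(stacked K p)) :
  (forall k, (k < K)%N -> blk u k = blk v k) -> u = v.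
Proof.
move=> uv; rewrite (mxcol_blk u) (mxcol_blk v).
by apply: eq_mxcol => k; exact: uv.
Qed.

Lemma blk0 p k : blk (0 : 'cV[R]_(stacked K p)) k = 0.
Proof. by rewrite /blk; case: insub => [j|] //; rewrite submxcol0. Qed.

Lemma blkD p (u v : 'cV[R]_(stacked K p)) k : blk (u + v) k = blk u k + blk v k.
Proof. by rewrite /blk; case: insub => [j|]; rewrite ?submxcolD ?addr0. Qed.

Lemma blkZ p a (u : 'cV[R]_(stacked K p)) k : blk (a *: u) k = a *: blk u k.
Proof.
rewrite /blk; case: insub => [j|]; last by rewrite scaler0.
by apply/matrixP => i l; rewrite !mxE.
Qed.

Lemma vec_ge0_mxcol p (f : nat -> 'cV[R]_p) :
  vec_ge0 (\mxcol_(k < K) f k) <-> forall k, (k < K)%N -> vec_ge0 (f k).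
Proof.
split=> [f_ge0 k kK i|f_ge0 s]; last by rewrite mxE; exact: f_ge0.
rewrite -(mxcolK (fun k : 'I_K => f k) (Ordinal kK)) mxE; exact: f_ge0.
Qed.

Lemma dot_mxcol p (f g : nat -> 'cV[R]_p) :
  dot (\mxcol_(k < K) f k) (\mxcol_(k < K) g k) = \sum_(k < K) dot (f k) (g k).
Proof.
by rewrite /dot tr_mxcol mul_mxrow_mxcol summxE.
Qed.

Lemma mul_Bdg p q (B : nat -> 'M[R]_(p, q)) (f : nat -> 'cV[R]_q) :
  Bdg K B *m \mxcol_(k < K) f k = \mxcol_(k < K) (B k *m f k).
Proof.
rewrite /Bdg mul_mxblock_mxrow; apply: eq_mxcol => k.
rewrite (bigD1 k)//= eqxx big1 ?addr0// => j /negPf jk.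
by rewrite eq_sym jk mul0mx.
Qed.

End Blocks.

(** * The Riccati recursion and the variation of the follower's cost *)

Section Riccati.
Context {R : realType} {K n : nat} {m c : player -> nat}.
Context (G : lqgame R K n m c) (P : nat -> 'M[R]_n).
Context (hric : riccati_condition G P).

Local Notation A := (dynA G).
Local Notation B1 := (dynB G leader).
Local Notation B2 := (dynB G follower).
Local Notation M2 := (conM G follower).
Local Notation N2 := (conN G follower follower).
Local Notation Q2 := (costQ G follower).
Local Notation R2 := (costR G follower follower).
Local Notation Gam := (Gamma G P).

Lemma Gamma_tr k : (k < K)%N -> (Gam k)^T = Gam k.
Proof. by case: hric => _ /[apply] -[/symmetric_tr]. Qed.

Lemma Gamma_unit k : (k < K)%N -> Gam k \in unitmx.
Proof. by case: hric => -[_ hP] _ /hP[]. Qed.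

Lemma riccati_tr k : (k <= K)%N -> (P k)^T = P k.
Proof.
case: hric => -[PK Prec] _.
have [j] := ubnP (K - k); elim: j k => // j IHj k; rewrite ltnS => le_j.
rewrite leq_eqVlt => /orP[/eqP->|kK].
  by rewrite PK symmetric_tr // costQ_sym.
have [_ ->] := Prec k kK.
rewrite !linearB !linearD /= !trmx_mul !trmxK trmx_inv.
rewrite (IHj k.+1)//; last first.
  by rewrite subnS; case: (K - k)%N (subn_gt0 k K) le_j => //; rewrite kK.
by rewrite Gamma_tr// symmetric_tr ?mulmxA// costQ_sym// ltnW.
Qed.

Definition feedback k (x : 'cV[R]_n) (v : 'cV[R]_(m leader)) (z : 'cV[R]_n)
    (nu : 'cV[R]_(c follower)) : 'cV[R]_(m follower) :=
  Lx G P k *m x + Lu G P k *m v + Lzeta G P k *m z + Lmu G P k *m nu.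

(** The gradient of the Lagrangian in the control of stage [k], for the costate
    [P_(k+1) x_(k+1) + z].  Eliminating [x_(k+1)] collects the control into
    [Gamma_k w], and the feedback law is defined so that [Gamma_k] times it
    cancels all the other terms. *)
Lemma control_gradient k x v w z nu : (k < K)%N ->
  R2 k *m w + (B2 k)^T *m (P k.+1 *m (A k *m x + B1 k *m v + B2 k *m w) + z)
    - (N2 k)^T *m nu
  = Gam k *m (w - feedback k x v z nu).
Proof.
move=> kK; rewrite /feedback /Lx /Lu /Lzeta /Lmu /Vmx.
rewrite !(mulmxBr, mulmxDr, mulNmx, mulmxN, mulmxA).
rewrite !(mulmxV (Gamma_unit kK), mul1mx).
rewrite {1}/Gamma !mulmxDl.
by apply/matrixP => i j; rewrite !(mxDE, mxNE); ring.
Qed.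

(** Costates [P_k x_k + zeta_k] satisfy the adjoint equation
    [lambda_k = Q x + A^T lambda_(k+1) - M^T mu] up to a term linear in the gap
    between the control and the feedback law. *)
Lemma costate_gradient k x v w z nu : (k < K)%N ->
  P k *m x + ((Abar G P k)^T *m z + Fbar G P k *m v + Gbar G P k *m nu)
  = Q2 k *m x + (A k)^T *m (P k.+1 *m (A k *m x + B1 k *m v + B2 k *m w) + z)
    - (M2 k)^T *m nu - (Vmx G P k)^T *m (w - feedback k x v z nu).
Proof.
move=> kK; have [[_ /(_ k kK)[_ ->]] _] := hric.
have VT : (Vmx G P k)^T = (A k)^T *m P k.+1 *m B2 k.
  by rewrite /Vmx !trmx_mul trmxK riccati_tr// mulmxA.
have AT : (Abar G P k)^T = (A k)^T - (Vmx G P k)^T *m invmx (Gam k) *m (B2 k)^T.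
  by rewrite /Abar /Lx mulmxN linearB /= !trmx_mul trmx_inv Gamma_tr.
rewrite AT /feedback /Fbar /Gbar /Lx /Lu /Lzeta /Lmu.
rewrite !(mulmxBr, mulmxDr, mulmxBl, mulmxDl, mulNmx, mulmxN, mulmxA).
rewrite -VT.
by apply/matrixP => i j; rewrite !(mxDE, mxNE); ring.
Qed.

(** In the two gradients the gap [e] contributes [Gamma e], paired with [d], and
    [V^T e], paired with [y]; they merge into one term because
    [Gamma Lx = - V].  The difference in the last line telescopes over the
    stages. *)
Lemma stage_variation k x v w z nu y d : (k < K)%N ->
  let lam := P k.+1 *m (A k *m x + B1 k *m v + B2 k *m w) + z in
  let lam0 :=
    P k *m x + ((Abar G P k)^T *m z + Fbar G P k *m v + Gbar G P k *m nu) in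
  dot (Q2 k *m x) y + dot (R2 k *m w) d
  = dot nu (M2 k *m y + N2 k *m d)
    + dot (w - feedback k x v z nu) (Gam k *m (d - Lx G P k *m y))
    - (dot lam (A k *m y + B2 k *m d) - dot lam0 y).
Proof.
move=> kK lam lam0; rewrite /lam0 (costate_gradient x v w z nu kK) -/lam.
have GLx : Gam k *m (d - Lx G P k *m y) = Gam k *m d + Vmx G P k *m y.
  by rewrite mulmxBr /Lx mulNmx mulmxN opprK !mulmxA mulmxV ?Gamma_unit ?mul1mx.
rewrite GLx; have := control_gradient x v w z nu kK; rewrite -/lam.
set e := w - _; clearbody lam e => /(congr1 (fun s => dot s d)).
rewrite !(dotDl, dotNl, dotDr, dotMr) Gamma_tr//; lra.
Qed.

(** The sum of [stage_variation] over the stages: [y 0 = 0] removes the boundary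
    term at time 0, and [z K = 0] with [P_K = Q_K] makes the one at time K the
    derivative of the terminal cost.  The left-hand side is the derivative of
    the cost when the control variation [d] causes the state variation [y]. *)
Lemma variation_identity (x : nat -> 'cV[R]_n) v w z nu
    (y : nat -> 'cV[R]_n) d :
  (forall k, (k < K)%N -> x k.+1 = A k *m x k + B1 k *m v k + B2 k *m w k) ->
  (forall k, (k < K)%N ->
    z k = (Abar G P k)^T *m z k.+1 + Fbar G P k *m v k + Gbar G P k *m nu k) ->
  z K = 0 ->
  (forall k, (k < K)%N -> y k.+1 = A k *m y k + B2 k *m d k) ->
  y 0%N = 0 ->
  dot (Q2 K *m x K) (y K)
    + \sum_(k < K) (dot (Q2 k *m x k) (y k) + dot (R2 k *m w k) (d k))
  = \sum_(k < K) dot (nu k) (M2 k *m y k + N2 k *m d k)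
    + \sum_(k < K) dot (w k - feedback k (x k) (v k) (z k.+1) (nu k))
                       (Gam k *m (d k - Lx G P k *m y k)).
Proof.
move=> xE zE zK yE y0.
(* the pairing of the costate with the state variation: zero at time 0, and
   the derivative of the terminal cost at time K *)
pose h k := dot (P k *m x k + z k) (y k).
have -> : \sum_(k < K) (dot (Q2 k *m x k) (y k) + dot (R2 k *m w k) (d k))
  = \sum_(k < K) (dot (nu k) (M2 k *m y k + N2 k *m d k)
     + dot (w k - feedback k (x k) (v k) (z k.+1) (nu k))
           (Gam k *m (d k - Lx G P k *m y k)) - (h k.+1 - h k)).
  apply: eq_bigr => -[k kK] _ /=.
  by rewrite (stage_variation (x k) (v k) _ (z k.+1) (nu k))// -xE// -zE// -yE.
rewrite sumrB big_split /= -(big_mkord xpredT (fun k => h k.+1 - h k)).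
rewrite telescope_sumr// /h y0 dot0r zK addr0.
by have [[-> _] _] := hric; ring.
Qed.

End Riccati.

(** * The follower's optimal reaction *)

Section Reaction.
Context {R : realType} {K n : nat} {m c : player -> nat}.
Context (G : lqgame R K n m c) (P : nat -> 'M[R]_n).
Context (hric : riccati_condition G P).

Local Notation A := (dynA G).
Local Notation B1 := (dynB G leader).
Local Notation B2 := (dynB G follower).
Local Notation M2 := (conM G follower).
Local Notation N2 := (conN G follower follower).
Local Notation Q2 := (costQ G follower).
Local Notation R2 := (costR G follower follower).
Local Notation Gam := (Gamma G P).
Local Notation strategy i := 'cV[R]_(stacked K (m i)).
Local Notation multiplier := 'cV[R]_(stacked K (c follower)).

(** The state of the homogeneous dynamics driven by [d] alone. *)
Fixpoint dstate (d : strategy follower) (k : nat) : 'cV[R]_n :=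
  if k is k'.+1 then A k' *m dstate d k' + B2 k' *m blk d k' else 0.

Lemma state_shift u1 u2 t d k :
  state G u1 (u2 + t *: d) k = state G u1 u2 k + t *: dstate d k.
Proof.
elim: k => [|k IHk] /=; first by rewrite scaler0 addr0.
rewrite IHk blkD blkZ !mulmxDr -!scalemxAr scalerDr.
by apply/matrixP => i j; rewrite !(mxDE, mxE); ring.
Qed.

Lemma dstate_lin a x y k : dstate (a *: x + y) k = a *: dstate x k + dstate y k.
Proof.
elim: k => [|k IHk] /=; first by rewrite scaler0 addr0.
rewrite IHk blkD blkZ !mulmxDr -!scalemxAr scalerDr.
by rewrite addrACA.
Qed.

Definition constraints i u1 u2 : 'cV[R]_(stacked K (c i)) :=
  \mxcol_(k < K) constraint G i k (state G u1 u2 k) (blk u1 k) (blk u2 k).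

Lemma blk_constraints i u1 u2 k : (k < K)%N ->
  blk (constraints i u1 u2) k
  = constraint G i k (state G u1 u2 k) (blk u1 k) (blk u2 k).
Proof.
exact: (blk_mxcol (fun k =>
  constraint G i k (state G u1 u2 k) (blk u1 k) (blk u2 k))).
Qed.

Lemma constraints_ge0 i u1 u2 :
  vec_ge0 (constraints i u1 u2) <-> admissible G i u1 u2.
Proof.
exact: (vec_ge0_mxcol (fun k =>
  constraint G i k (state G u1 u2 k) (blk u1 k) (blk u2 k))).
Qed.

Definition dconstraints d : multiplier :=
  \mxcol_(k < K) (M2 k *m dstate d k + N2 k *m blk d k).

Lemma blk_dconstraints d k : (k < K)%N ->
  blk (dconstraints d) k = M2 k *m dstate d k + N2 k *m blk d k.
Proof. exact: (blk_mxcol (fun k => M2 k *m dstate d k + N2 k *m blk d k)). Qed.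

Lemma constraints_shift u1 u2 t d :
  constraints follower u1 (u2 + t *: d)
  = constraints follower u1 u2 + t *: dconstraints d.
Proof.
apply: blk_inj => k kK; rewrite blkD blkZ.
rewrite !blk_constraints// blk_dconstraints//.
rewrite /constraint state_shift blkD blkZ !mulmxDr -!scalemxAr scalerDr.
by apply/matrixP => i j; rewrite !(mxDE, mxE); ring.
Qed.

Lemma dconstraints_lin a x y :
  dconstraints (a *: x + y) = a *: dconstraints x + dconstraints y.
Proof.
apply: blk_inj => k kK; rewrite blkD blkZ.
rewrite !blk_dconstraints// dstate_lin blkD blkZ !mulmxDr -!scalemxAr scalerDr.
by rewrite addrACA.
Qed.

Definition cost_grad u1 u2 d : R :=
  dot (Q2 K *m state G u1 u2 K) (dstate d K)
  + \sum_(k < K) (dot (Q2 k *m state G u1 u2 k) (dstate d k)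
                  + dot (R2 k *m blk u2 k) (blk d k)).

(** Half of the Hessian form: the coefficient of [t ^+ 2] in [cost_shift]. *)
Definition cost_hess d : R :=
  2%:R^-1 * (wnorm2 (Q2 K) (dstate d K)
  + \sum_(k < K) (wnorm2 (Q2 k) (dstate d k) + wnorm2 (R2 k) (blk d k))).

Lemma cost_grad_lin u1 u2 : scalar (cost_grad u1 u2).
Proof.
move=> a x y; rewrite /cost_grad dstate_lin dotDr dotZr.
under eq_bigr => k _.
  rewrite dstate_lin blkD blkZ !dotDr !dotZr addrACA -mulrDr; over.
by rewrite big_split -mulr_sumr /=; ring.
Qed.

Lemma cost_shift u1 u2 t d :
  cost G follower u1 (u2 + t *: d)
  = cost G follower u1 u2 + t * cost_grad u1 u2 d + t ^+ 2 * cost_hess d.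
Proof.
have QT k : (k <= K)%N -> (Q2 k)^T = Q2 k.
  by move=> kK; exact: symmetric_tr (costQ_sym G follower kK).
rewrite /cost state_shift wnorm2_shift ?QT//.
have -> : \sum_(k < K) (wnorm2 (Q2 k) (state G u1 (u2 + t *: d) k)
    + wnorm2 (costR G follower leader k) (blk u1 k)
    + wnorm2 (R2 k) (blk (u2 + t *: d) k))
  = \sum_(k < K) (wnorm2 (Q2 k) (state G u1 u2 k)
    + wnorm2 (costR G follower leader k) (blk u1 k)
    + wnorm2 (R2 k) (blk u2 k))
  + 2%:R * t * (\sum_(k < K) (dot (Q2 k *m state G u1 u2 k) (dstate d k)
                  + dot (R2 k *m blk u2 k) (blk d k)))
  + t ^+ 2 * (\sum_(k < K) (wnorm2 (Q2 k) (dstate d k)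
                  + wnorm2 (R2 k) (blk d k))).
  rewrite !mulr_sumr -!big_split; apply: eq_bigr => -[k kK] _ /=.
  have RT : (R2 k)^T = R2 k.
    exact: symmetric_tr (costR_sym G follower follower kK).
  by rewrite state_shift blkD blkZ !wnorm2_shift ?QT ?(ltnW kK)//; ring.
by rewrite /cost_grad /cost_hess; field.
Qed.

(** The solution of the backward recursion [zeta_rec] with [zeta_end]. *)
Definition zeta (u1 : strategy leader) (nu : multiplier) (k : nat) : 'cV[R]_n :=
  \sum_(k <= j < K)
    Psi G P k j *m (Fbar G P j *m blk u1 j + Gbar G P j *m blk nu j).

Lemma zeta_end u1 nu : zeta u1 nu K = 0.
Proof. by rewrite /zeta big_geq. Qed.

Lemma zeta_rec u1 nu k : (k < K)%N ->
  zeta u1 nu k = (Abar G P k)^T *m zeta u1 nu k.+1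
                 + Fbar G P k *m blk u1 k + Gbar G P k *m blk nu k.
Proof.
move=> kK; rewrite /zeta big_ltn//.
have -> : Psi G P k k = 1%:M by rewrite /Psi big_geq.
rewrite mul1mx mulmx_sumr [LHS]addrC -[RHS]addrA; congr (_ + _).
apply: eq_big_nat => j /andP[kj _]; rewrite mulmxA; congr (_ *m _).
by rewrite /Psi big_ltn.
Qed.

Definition deviation u1 u2 nu k : 'cV[R]_(m follower) :=
  blk u2 k
  - feedback G P k (state G u1 u2 k) (blk u1 k) (zeta u1 nu k.+1) (blk nu k).

Lemma cost_gradE u1 u2 nu d :
  cost_grad u1 u2 d = dot nu (dconstraints d)
  + \sum_(k < K) dot (deviation u1 u2 nu k)
                     (Gam k *m (blk d k - Lx G P k *m dstate d k)).
Proof.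
rewrite [X in dot X (dconstraints d)]mxcol_blk.
rewrite (dot_mxcol (blk nu) (fun k => M2 k *m dstate d k + N2 k *m blk d k)).
exact: (variation_identity hric _ (@zeta_rec u1 nu) (zeta_end u1 nu)).
Qed.

(** [variation_identity] for the homogeneous problem in which the control and
    its variation are both [d]. *)
Lemma cost_hessE d :
  cost_hess d
  = 2%:R^-1 * \sum_(k < K) wnorm2 (Gam k) (blk d k - Lx G P k *m dstate d k).
Proof.
congr (_ * _); rewrite wnorm2E dotC.
under eq_bigr do
  rewrite !wnorm2E [dot (dstate _ _) _]dotC [dot (blk _ _) _]dotC.
have := @variation_identity R K n m c G P hric (dstate d) (fun=> 0) (blk d)
  (fun=> 0) (fun=> 0) (dstate d) (blk d).
move=> ->//; last 2 first.
- by move=> k _; rewrite mulmx0 addr0.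
- by move=> k _; rewrite !mulmx0 !addr0.
rewrite big1 ?add0r; last by move=> k _; rewrite dotC dot0r.
by apply: eq_bigr => k _; rewrite wnorm2E /feedback !mulmx0 !addr0.
Qed.

(** Under the feedback [Lx] the homogeneous state never leaves its initial
    value 0. *)
Lemma dstate_eq0 d :
  (forall k, (k < K)%N -> blk d k = Lx G P k *m dstate d k) -> d = 0.
Proof.
move=> dE.
have s0 k : (k <= K)%N -> dstate d k = 0.
  elim: k => // k IHk kK /=; rewrite dE// IHk ?(ltnW kK)//.
  by rewrite !mulmx0 addr0.
by apply: blk_inj => k kK; rewrite dE// s0 ?(ltnW kK)// mulmx0 blk0.
Qed.

Lemma wnorm2_Gamma_ge0 k x : (k < K)%N -> 0 <= wnorm2 (Gam k) x.
Proof.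
case: hric => _ /[apply] -[_ pos].
have [->|x0] := eqVneq x 0; first by rewrite wnorm2E mulmx0 dot0r.
exact/ltW/pos.
Qed.

Lemma sum_wnorm2_Gamma_eq0 (e : nat -> 'cV[R]_(m follower)) :
  \sum_(k < K) wnorm2 (Gam k) (e k) <= 0 -> forall k, (k < K)%N -> e k = 0.
Proof.
move=> e_le0 k kK; apply/eqP; apply: contraT => ek0.
have := e_le0; rewrite leNgt => /negP[].
rewrite (bigD1 (Ordinal kK))//= ltr_pwDl//.
  by case: hric => _ /(_ k kK)[_ ->].
by apply: sumr_ge0 => -[j jK] _; exact: wnorm2_Gamma_ge0.
Qed.

Lemma cost_hess_ge0 d : 0 <= cost_hess d.
Proof.
rewrite cost_hessE mulr_ge0//; apply: sumr_ge0 => -[k kK] _.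
exact: wnorm2_Gamma_ge0.
Qed.

Lemma cost_hess_eq0 d : cost_hess d <= 0 -> d = 0.
Proof.
rewrite cost_hessE pmulr_rle0// => hess_le0; apply: dstate_eq0 => k kK.
apply/eqP; rewrite -subr_eq0; apply/eqP.
exact: (@sum_wnorm2_Gamma_eq0 (fun k => blk d k - Lx G P k *m dstate d k)).
Qed.

(** [d] is obtained by running the homogeneous system in closed loop, with [e]
    added to the feedback [Lx]. *)
Lemma deviation_direction (e : nat -> 'cV[R]_(m follower)) :
  exists d, forall k, (k < K)%N -> blk d k - Lx G P k *m dstate d k = e k.
Proof.
pose y := fix y k := if k is k'.+1 then
  A k' *m y k' + B2 k' *m (Lx G P k' *m y k' + e k') else 0 : 'cV[R]_n.
exists (\mxcol_(k < K) (Lx G P k *m y k + e k)) => k kK.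
have yE : forall j, (j <= K)%N ->
    dstate (\mxcol_(k < K) (Lx G P k *m y k + e k)) j = y j.
  elim=> // j IHj jK /=.
  by rewrite (blk_mxcol (fun k => Lx G P k *m y k + e k))// IHj// ltnW.
rewrite (blk_mxcol (fun k => Lx G P k *m y k + e k))// yE ?(ltnW kK)//.
by rewrite addrC addKr.
Qed.

(** With zero deviation the derivative of the cost towards a feasible [v] is
    the pairing of [nu] with the constraint values at [v], which is
    nonnegative; the second-order term makes the minimizer unique. *)
Lemma reaction_sufficient u1 u2 nu :
  complementary nu (constraints follower u1 u2) ->
  (forall k, (k < K)%N -> deviation u1 u2 nu k = 0) ->
  reaction G u1 = [set u2]%classic.
Proof.
move=> [nu_ge0 g_ge0 slack] dev0.
have cost_gap v : Omega2 G u1 v ->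
    cost G follower u1 u2 + cost_hess (v - u2) <= cost G follower u1 v.
  move=> /constraints_ge0 gv_ge0.
  have -> : v = u2 + 1 *: (v - u2) by rewrite scale1r addrC subrK.
  rewrite cost_shift [in X in _ + cost_hess X]scale1r (addrC u2) addrK.
  rewrite expr1n !mul1r (cost_gradE _ _ nu).
  have -> : \sum_(k < K) dot (deviation u1 u2 nu k)
      (Gam k *m (blk (v - u2) k - Lx G P k *m dstate (v - u2) k)) = 0.
    by apply: big1 => -[k kK] _; rewrite dev0// dotC dot0r.
  have := constraints_shift u1 u2 1 (v - u2).
  rewrite !scale1r addrCA subrr addr0 => gvE.
  rewrite addr0 lerD2r lerDl.
  have -> : dot nu (dconstraints (v - u2)) = dot nu (constraints follower u1 v).
    by rewrite gvE dotDr [dot nu (constraints _ _ _)]slack add0r.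
  by rewrite dotE sumr_ge0// => i _; rewrite mulr_ge0.
have u2_min : reaction G u1 u2.
  split=> [|v /cost_gap]; first exact/constraints_ge0.
  by apply: le_trans; rewrite lerDl cost_hess_ge0.
apply/seteqP; split=> v /= => [[v_feas v_min]|->//].
apply/eqP; rewrite -subr_eq0; apply/eqP/cost_hess_eq0.
have := cost_gap v v_feas; have := v_min u2 u2_min.1; lra.
Qed.

(** The multipliers of [kkt_necessary] annihilate the last sum in [cost_gradE]
    for every [d]; for the direction of [deviation_direction] that sum is the
    sum of the squared [Gamma]-norms of the deviations. *)
Lemma reaction_necessary u1 u2 :
  reaction G u1 u2 ->
  exists nu : multiplier, complementary nu (constraints follower u1 u2) /\
    forall k, (k < K)%N -> deviation u1 u2 nu k = 0.
Proof.
move=> [/constraints_ge0 u2_feas u2_min].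
have [v /constraints_ge0|nu [nu_compl gradE]] :=
  kkt_necessary (cost_grad_lin u1 u2) dconstraints_lin (cost_shift u1 u2)
    (constraints_shift u1 u2) u2_feas.
  exact: u2_min.
exists nu; split=> //; apply: sum_wnorm2_Gamma_eq0.
have [d dE] := deviation_direction (deviation u1 u2 nu).
have := cost_gradE u1 u2 nu d; rewrite gradE => /eqP.
rewrite addrC -subr_eq subrr => /eqP sum0; rewrite [leRHS]sum0.
by apply: ler_sum => -[k kK] _ /=; rewrite dE// wnorm2E.
Qed.

End Reaction.

(** * The stacked closed-loop system and the leader's program *)

Lemma wnorm2_block (R : realType) p q (S : 'M[R]_p) (T : 'M[R]_q) x y :
  wnorm2 (block_mx S 0 0 T) (col_mx x y) = wnorm2 S x + wnorm2 T y.
Proof.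
rewrite /wnorm2 tr_col_mx mul_row_block !mulmx0 addr0 add0r mul_row_col.
by rewrite mxDE.
Qed.

Lemma wnorm2_Bdg (R : realType) K p (S : nat -> 'M[R]_p)
    (u : 'cV[R]_(stacked K p)) :
  wnorm2 (Bdg K S) u = \sum_(k < K) wnorm2 (S k) (blk u k).
Proof.
rewrite wnorm2E (mxcol_blk u) (mul_Bdg S (blk u)) -(mxcol_blk u).
rewrite {1}(mxcol_blk u) (dot_mxcol (blk u) (fun k => S k *m blk u k)).
by apply: eq_bigr => k _; rewrite wnorm2E.
Qed.

Section Leader.
Context {R : realType} {K n : nat} {m c : player -> nat}.
Context (G : lqgame R K n m c) (P : nat -> 'M[R]_n).

Local Notation strategy i := 'cV[R]_(stacked K (m i)).
Local Notation multiplier := 'cV[R]_(stacked K (c follower)).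
Implicit Type nu : multiplier.

Lemma PhiS k i : (i <= k)%N -> Phi G P k.+1 i = Abar G P k *m Phi G P k i.
Proof.
move=> ik; rewrite /Phi /index_iota subSn// -addn1 iotaD rev_cat subnKC//=.
by rewrite big_cons.
Qed.

Lemma Phi_id k : Phi G P k k = 1%:M.
Proof. by rewrite /Phi /index_iota subnn big_nil. Qed.

(** The part of the closed-loop dynamics that does not depend on the state. *)
Definition drive (u1 : strategy leader) nu k : 'cV[R]_n :=
  Bbar G P k *m blk u1 k + Cbar G P k *m blk nu k
  + Dbar G P k *m zeta G P u1 nu k.+1.

(** The variation-of-constants formula for the closed-loop recursion
    [trajS]. *)
Definition traj (u1 : strategy leader) nu k : 'cV[R]_n :=
  Phi G P k 0 *m init G + \sum_(j < k) Phi G P k j.+1 *m drive u1 nu j.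

Lemma trajS u1 nu k :
  traj u1 nu k.+1 = Abar G P k *m traj u1 nu k + drive u1 nu k.
Proof.
rewrite /traj big_ord_recr /= Phi_id mul1mx PhiS// mulmxDr mulmxA -addrA.
congr (_ + (_ + _)); rewrite mulmx_sumr; apply: eq_bigr => -[j jk] _ /=.
by rewrite PhiS// mulmxA.
Qed.

Definition closed_loop (u1 : strategy leader) nu k : 'cV[R]_(m follower) :=
  feedback G P k (traj u1 nu k) (blk u1 k) (zeta G P u1 nu k.+1) (blk nu k).

Lemma state_traj_step u1 u2 nu k :
  state G u1 u2 k = traj u1 nu k -> blk u2 k = closed_loop u1 nu k ->
  state G u1 u2 k.+1 = traj u1 nu k.+1.
Proof.
move=> /= -> ->; rewrite trajS /drive /closed_loop /feedback.
rewrite /Abar /Bbar /Cbar /Dbar.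
rewrite !(mulmxDr, mulmxDl, mulmxA).
by apply/matrixP => i j; rewrite !mxDE; ring.
Qed.

Lemma traj0 u1 nu : traj u1 nu 0 = init G.
Proof. by rewrite /traj Phi_id mul1mx big_ord0 addr0. Qed.

Lemma state_traj u1 u2 nu :
  u2 = \mxcol_(k < K) closed_loop u1 nu k ->
  forall k, (k <= K)%N -> state G u1 u2 k = traj u1 nu k.
Proof.
move=> u2E; elim=> [|k IHk] kK; first by rewrite traj0.
apply: state_traj_step; first exact/IHk/ltnW.
by rewrite u2E (blk_mxcol (closed_loop u1 nu)).
Qed.

(** [deviation] compares [u2] with the feedback along the trajectory of [u2],
    whereas [closed_loop] is the feedback along the closed-loop trajectory.  In
    either case agreement with the feedback at the stages before [k] forces
    the two trajectories to agree up to [k]. *)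
Lemma deviation_eq0P u1 u2 nu :
  (forall k, (k < K)%N -> deviation G P u1 u2 nu k = 0) <->
  u2 = \mxcol_(k < K) closed_loop u1 nu k.
Proof.
split=> [dev0|u2E k kK].
  have u2E k : (k < K)%N -> blk u2 k = feedback G P k (state G u1 u2 k)
      (blk u1 k) (zeta G P u1 nu k.+1) (blk nu k).
    by move=> /dev0/eqP; rewrite subr_eq0 => /eqP.
  have stateE k : (k <= K)%N -> state G u1 u2 k = traj u1 nu k.
    elim: k => [|k IHk] kK; first by rewrite traj0.
    have xk := IHk (ltnW kK).
    by apply: state_traj_step => //; rewrite u2E// xk.
  apply: blk_inj => k kK; rewrite (blk_mxcol (closed_loop u1 nu))// u2E//.
  by rewrite stateE// ltnW.
rewrite /deviation (state_traj u2E (ltnW kK)) u2E.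
by rewrite (blk_mxcol (closed_loop u1 nu))// subrr.
Qed.

Lemma costates_stacked u1 nu :
  PsiB G P *m FF G P *m u1 + PsiB G P *m GG G P *m nu
  = \mxcol_(k < K) zeta G P u1 nu k.+1.
Proof.
rewrite -!mulmxA -mulmxDr {1}(mxcol_blk u1) {1}(mxcol_blk nu).
rewrite (mul_Bdg (Fbar G P) (blk u1)) (mul_Bdg (Gbar G P) (blk nu)) -mxcolD.
rewrite mul_mxblock_mxrow; apply: eq_mxcol => i; rewrite /zeta.
rewrite (big_nat_widenl i.+1 0)// big_mkcond /= big_mkord.
by apply: eq_bigr => j _; case: ifP => //; rewrite mul0mx.
Qed.

Lemma drive_stacked u1 nu :
  BB G P *m u1 + CC G P *m nu
    + DD G P *m (PsiB G P *m FF G P *m u1 + PsiB G P *m GG G P *m nu)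
  = \mxcol_(k < K) drive u1 nu k.
Proof.
rewrite costates_stacked {1}(mxcol_blk u1) {1}(mxcol_blk nu).
rewrite (mul_Bdg (Bbar G P) (blk u1)) (mul_Bdg (Cbar G P) (blk nu)).
by rewrite (mul_Bdg (Dbar G P) (fun k => zeta G P u1 nu k.+1)) -!mxcolD.
Qed.

Lemma states_stacked u1 nu :
  Phi0 G P *m init G + Theta_u G P *m u1 + Theta_mu G P *m nu
  = \mxcol_(k < K) traj u1 nu k.
Proof.
have -> : Phi0 G P *m init G + Theta_u G P *m u1 + Theta_mu G P *m nu
    = Phi0 G P *m init G + PhiB G P *m \mxcol_(k < K) drive u1 nu k.
  rewrite -drive_stacked /Theta_u /Theta_mu !(mulmxDr, mulmxDl, mulmxA).
  by apply/matrixP => i j; rewrite !mxDE; ring.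
rewrite mxcol_mul mul_mxblock_mxrow -mxcolD; apply: eq_mxcol => i.
rewrite /traj; congr (_ + _).
have iK : (i <= K)%N by rewrite ltnW.
rewrite [RHS](big_ord_widen K (fun j => Phi G P i j.+1 *m drive u1 nu j) iK).
rewrite [RHS]big_mkcond /=.
by apply: eq_bigr => j _; case: ifP => //; rewrite mul0mx.
Qed.

Lemma final_stacked u1 nu :
  theta_u G P *m u1 + theta_mu G P *m nu + Phi G P K 0 *m init G
  = traj u1 nu K.
Proof.
rewrite addrC; congr (_ + _).
rewrite -(mul_mxrow_mxcol (fun j : 'I_K => Phi G P K j.+1)) -drive_stacked.
rewrite /theta_u /theta_mu /PhiK !(mulmxDr, mulmxDl, mulmxA).
by apply/matrixP => i j; rewrite !mxDE; ring.
Qed.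

Lemma response_closed_loop u1 nu :
  let zr := PsiB G P *m FF G P *m u1 + PsiB G P *m GG G P *m nu in
  let xl := Phi0 G P *m init G + Theta_u G P *m u1 + Theta_mu G P *m nu in
  response G P xl u1 zr nu = \mxcol_(k < K) closed_loop u1 nu k.
Proof.
rewrite /= costates_stacked states_stacked; apply: eq_mxcol => k.
rewrite (blk_mxcol (traj u1 nu))//.
by rewrite (blk_mxcol (fun k => zeta G P u1 nu k.+1)).
Qed.

Lemma response_stacked u1 nu :
  Lambda_u G P *m u1 + Lambda_mu G P *m nu + Lambda_0 G P *m init G
  = \mxcol_(k < K) closed_loop u1 nu k.
Proof.
have -> : Lambda_u G P *m u1 + Lambda_mu G P *m nu + Lambda_0 G P *m init G
    = LLx G P *m (\mxcol_(k < K) traj u1 nu k) + LLu G P *m u1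
      + LLzeta G P *m (\mxcol_(k < K) zeta G P u1 nu k.+1) + LLmu G P *m nu.
  rewrite -states_stacked -costates_stacked /Lambda_u /Lambda_mu /Lambda_0.
  rewrite !(mulmxDr, mulmxDl, mulmxA).
  by apply/matrixP => i j; rewrite !mxDE; ring.
rewrite {2}(mxcol_blk u1) {3}(mxcol_blk nu).
rewrite (mul_Bdg (Lx G P) (traj u1 nu)) (mul_Bdg (Lu G P) (blk u1)).
rewrite (mul_Bdg (Lzeta G P) (fun k => zeta G P u1 nu k.+1)).
by rewrite (mul_Bdg (Lmu G P) (blk nu)) -!mxcolD.
Qed.

(** In terms of the stacked states and costates the aggregate matrices become
    block diagonal, and at each stage [E], [S], [U] and [W] are the constraint
    matrices composed with the feedback law. *)
Lemma constraints_stacked i u1 u2 nu :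
  u2 = \mxcol_(k < K) closed_loop u1 nu k ->
  NN G P i *m u1 + VV G P i *m nu + qq G P i = constraints G i u1 u2.
Proof.
move=> u2E.
have -> : NN G P i *m u1 + VV G P i *m nu + qq G P i
    = EE G P i *m (\mxcol_(k < K) traj u1 nu k) + SS G P i *m u1
      + UU G P i *m nu + WW G P i *m (\mxcol_(k < K) zeta G P u1 nu k.+1)
      + rr G i.
  rewrite -states_stacked -costates_stacked /NN /VV /qq /TT /Theta_u /Theta_mu.
  rewrite !(mulmxDr, mulmxDl, mulmxA).
  by apply/matrixP => a b; rewrite !mxDE; ring.
rewrite [X in SS _ _ _ *m X]mxcol_blk [X in UU _ _ _ *m X]mxcol_blk.
rewrite (mul_Bdg (Emx G P i) (traj u1 nu)) (mul_Bdg (Smx G P i) (blk u1)).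
rewrite (mul_Bdg (Umx G P i) (blk nu)).
rewrite (mul_Bdg (Wmx G P i) (fun k => zeta G P u1 nu k.+1)) -!mxcolD.
apply: eq_mxcol => -[k kK] /=.
rewrite (state_traj u2E (ltnW kK)) u2E (blk_mxcol (closed_loop u1 nu))//.
rewrite /constraint /closed_loop /feedback /Emx /Smx /Umx /Wmx.
rewrite !(mulmxDr, mulmxDl, mulmxA).
by apply/matrixP => a b; rewrite !mxDE; ring.
Qed.

(** [Delta] and [xi0] stack the final state, the states and both strategies,
    which [Sigma] weighs as the leader's cost does. *)
Lemma objective_cost u1 u2 nu :
  u2 = \mxcol_(k < K) closed_loop u1 nu k ->
  LCQP_objective G P u1 nu = cost G leader u1 u2.
Proof.
move=> u2E; rewrite /LCQP_objective /cost -mulrDr; congr (_ * _).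
have -> : Delta G P *m col_mx u1 nu + xi0 G P *m init G
    = col_mx (traj u1 nu K)
             (col_mx (\mxcol_(k < K) traj u1 nu k) (col_mx u1 u2)).
  rewrite /Delta /xi0 !mul_col_mx !mul_row_col !add_col_mx.
  rewrite final_stacked -states_stacked u2E -response_stacked.
  rewrite mul1mx !mul0mx !addr0; congr (col_mx _ (col_mx _ _)).
  by rewrite addrC addrA.
rewrite !wnorm2_block !wnorm2_Bdg (state_traj u2E (leqnn K)); congr (_ + _).
rewrite -!big_split; apply: eq_bigr => -[k kK] _ /=.
by rewrite (blk_mxcol (traj u1 nu))// (state_traj u2E (ltnW kK)) addrA.
Qed.

Lemma LCQP_feasibleE u1 u2 nu :
  u2 = \mxcol_(k < K) closed_loop u1 nu k ->
  LCQP_feasible G P u1 nu <->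
  admissible G leader u1 u2 /\ complementary nu (constraints G follower u1 u2).
Proof.
move=> u2E.
by rewrite /LCQP_feasible !(constraints_stacked _ u2E) constraints_ge0.
Qed.

Lemma reaction_complementarity (hric : riccati_condition G P) u1 u2 :
  reaction G u1 = [set u2]%classic <->
  exists2 nu, u2 = \mxcol_(k < K) closed_loop u1 nu k
            & complementary nu (constraints G follower u1 u2).
Proof.
split=> [reactE|[nu /deviation_eq0P dev0 nu_compl]]; last first.
  exact: (reaction_sufficient hric nu_compl).
have : reaction G u1 u2 by rewrite reactE.
move=> /(reaction_necessary hric)[nu [nu_compl /deviation_eq0P u2E]].
by exists nu.
Qed.

(** Feasibility contains the follower's optimality conditions, so the reaction
    is single-valued and given by the feedback law. *)
Lemma LCQP_feasible_Omega1 (hric : riccati_condition G P) u1 nu u2 :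
  u2 = \mxcol_(k < K) closed_loop u1 nu k -> LCQP_feasible G P u1 nu ->
  Omega1 G u1 /\ reaction G u1 = [set u2]%classic.
Proof.
move=> u2E /(LCQP_feasibleE u2E)[adm compl].
have reactE : reaction G u1 = [set u2]%classic.
  by apply/reaction_complementarity => //; exists nu.
have u2_reacts : reaction G u1 u2 by rewrite reactE.
by split=> //; split; [exists u2; exact: u2_reacts.1|exists u2].
Qed.

(** Membership in [Omega1] speaks of some strategy that is the only reaction; it
    is the given [u2], and its multipliers complete [u1] to a feasible
    point. *)
Lemma Omega1_LCQP_feasible (hric : riccati_condition G P) u1 u2 :
  Omega1 G u1 -> reaction G u1 = [set u2]%classic ->
  exists2 nu, u2 = \mxcol_(k < K) closed_loop u1 nu k & LCQP_feasible G P u1 nu.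
Proof.
move=> [_ [v vE adm]] reactE.
have vu : v = u2 by have : [set u2]%classic v by rewrite -reactE vE.
have [nu u2E compl] := (reaction_complementarity hric u1 u2).1 reactE.
by exists nu => //; apply/(LCQP_feasibleE u2E); split=> //; rewrite -vu.
Qed.

End Leader.

Theorem theorem2 (R : realType) (K n : nat) (m c : player -> nat)
    (G : lqgame R K n m c) (P : nat -> 'M[R]_n)
    (hK : (1 <= K)%N)
    (hreg : regularity G)
    (hric : riccati_condition G P)
    (u1s : 'cV[R]_(stacked K (m leader)))
    (u2s : 'cV[R]_(stacked K (m follower))) :
  GOLSE G u1s u2s <->
  exists mus : 'cV[R]_(stacked K (c follower)),
    LCQP_minimizer G P u1s mus /\
    let zr := PsiB G P *m FF G P *m u1s + PsiB G P *m GG G P *m mus in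
    let xl := Phi0 G P *m init G + Theta_u G P *m u1s + Theta_mu G P *m mus in
    u2s = response G P xl u1s zr mus.
Proof.
split=> [[u1s_Om reactE opt]|[mus [[feas opt] /=]]].
  have [mus u2E feas] := Omega1_LCQP_feasible hric u1s_Om reactE.
  exists mus; split; last by rewrite /= response_closed_loop.
  split=> // v nu v_feas.
  have [v_Om v_reactE] := LCQP_feasible_Omega1 hric erefl v_feas.
  by rewrite (objective_cost u2E) (objective_cost erefl) opt.
rewrite response_closed_loop => u2E.
have [u1s_Om reactE] := LCQP_feasible_Omega1 hric u2E feas.
split=> // v1 v2 v_Om v_reactE.
have [nu v2E v_feas] := Omega1_LCQP_feasible hric v_Om v_reactE.
by rewrite -(objective_cost u2E) -(objective_cost v2E) opt.
Qed.
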